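(* Consider any iteration of the Dantzig-Wolfe-Fenchel decomposition method (described in the context, for a single decomposed polyhedron $Q_2$) in which the sub-problem is solved, and let $x^*$ be the point of $Q_2$ found by the sub-problem at this iteration. Then $x^*$ invalidates either all the optimal dual solutions of the current Dantzig-Wolfe master program or none of them.
   Context: **Problem.** Let $X=\mathbb{R}^p\times\mathbb{Z}^q$, $\bar X=\mathbb{R}^{p+q}$, and consider the mixed integer linear program $\max\{cx : A_1x\le b_1,\ A_2x\le b_2,\ x\in X\}$. Let $LR_1=\{x\in\bar X : A_1x\le b_1\}$, $LR_2=\{x\in\bar X : A_2x\le b_2\}$ and $Q_2=\mathrm{conv}(\{x\in X : A_2x\le b_2\})$. These are assumed to be bounded polyhedra. **Approximations and master problems.** At every iteration the method has: - an inner approximation $\widehat Q_2=\mathrm{conv}\{x_i : i\in I\}\subseteq Q_2$, with $x_i\in Q_2$ and $I$ finite, such that $LR_1\cap\widehat Q_2\neq\emptyset$; - an outer approximation $\check Q_2\supseteq Q_2$ described by finitely many inequalities valid for $Q_2$. The Dantzig-Wolfe master program is $$\max\Big\{cx : A_1x\le b_1,\ x=\sum_{i\in I}\lambda_ix_i,\ \sum_{i\in I}\lambda_i=1,\ x\in\bar X,\ \lambda_i\ge 0\ (i\in I)\Big\},$$ i.e. it maximizes $cx$ over $LR_1\cap\widehat Q_2$; let $\widehat x$ be the $x$-part of an optimal solution. The Fenchel master program maximizes $cx$ over $LR_1\cap\check Q_2$; let $\check x$ be an optimal solution. If $c\widehat x=c\check x$, the method stops, without solving the sub-problem. Otherwise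 (so $c\check x>c\widehat x$) the sub-problem is solved: it separates $\check x$ from $Q_2$ with the directional normalization toward $\widehat x$, and thereby finds the point $x^*$ of $Q_2$ on the segment $[\widehat x,\check x]$ that is farthest from $\widehat x$ (equivalently, closest to $\check x$). **Dual solutions and invalidation.** Let $u,\pi,\pi_0$ be the dual variables of the constraints $A_1x\le b_1$, $x=\sum_i\lambda_ix_i$ and $\sum_i\lambda_i=1$. The dual of the Dantzig-Wolfe master program is $$\min\{ub_1+\pi_0 : uA_1+\pi=c,\ \pi x_i\le\pi_0\ (i\in I),\ u\ge 0\}.$$ For an optimal dual solution $(u,\pi,\pi_0)$, the inequality $uA_1x\le ub_1$ is valid for $LR_1$, the inequality $\pi x\le\pi_0$ is valid for $\widehat Q_2$, and they sum to the bound $cx\le c\widehat x$, which certifies the optimality of $\widehat x$ over $LR_1\cap\widehat Q_2$. A point $y\in Q_2$ *invalidates* the dual solution $(u,\pi,\pi_0)$ if it violates the inequality $\pi x\le\pi_0$, i.e. $\pi y>\pi_0$. *)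

(* Defs.v *)
From mathcomp Require Import all_boot all_order all_algebra.
From mathcomp Require Import all_classical all_reals all_analysis.

Set Implicit Arguments.
Unset Strict Implicit.
Unset Printing Implicit Defensive.

Import Order.TTheory GRing.Theory Num.Theory.
Import numFieldNormedType.Exports.

Local Open Scope classical_set_scope.
Local Open Scope ring_scope.

(* Points are column vectors; objectives and dual vectors are row vectors. *)

Definition dotp (R : realType) (n : nat) (c : 'rV[R]_n) (x : 'cV[R]_n) : R :=
  (c *m x) 0 0.

Definition polyhedron (R : realType) (m n : nat)
    (A : 'M[R]_(m, n)) (b : 'cV[R]_m) : set 'cV[R]_n :=
  [set x | forall i, (A *m x) i 0 <= b i 0].

Definition bounded_polyhedron (R : realType) (n : nat)
    (S : set 'cV[R]_n) : Prop :=
  bounded_set S /\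
  exists (m : nat) (A : 'M[R]_(m, n)) (b : 'cV[R]_m), S = polyhedron A b.

Definition mixed_integer (R : realType) (p q : nat) : set 'cV[R]_(p + q) :=
  [set x | forall j : 'I_q, x (rshift p j) 0 \is a Num.int].

Definition conv_hull (R : realType) (n : nat) (S : set 'cV[R]_n) :
    set 'cV[R]_n :=
  smallest (@convex_set R 'cV[R]_n) S.

Definition mixed_integer_hull (R : realType) (p q m : nat)
    (A : 'M[R]_(m, p + q)) (b : 'cV[R]_m) : set 'cV[R]_(p + q) :=
  conv_hull (@mixed_integer R p q `&` polyhedron A b).

Definition is_max (R : realType) (T : Type) (S : set T) (f : T -> R) (x : T) :
    Prop :=
  S x /\ forall y, S y -> f y <= f x.

Definition is_min (R : realType) (T : Type) (S : set T) (f : T -> R) (x : T) :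
    Prop :=
  S x /\ forall y, S y -> f x <= f y.

Definition dw_primal_feasible (R : realType) (n m : nat) (I : finType)
    (A1 : 'M[R]_(m, n)) (b1 : 'cV[R]_m) (xs : I -> 'cV[R]_n) :
    set ('cV[R]_n * {ffun I -> R}) :=
  [set z : 'cV[R]_n * {ffun I -> R} | let: (x, lambda) := z in
     [/\ polyhedron A1 b1 x,
         x = \sum_i lambda i *: xs i,
         \sum_i lambda i = 1
       & forall i, 0 <= lambda i]].

Definition dw_primal_optimal (R : realType) (n m : nat) (I : finType)
    (c : 'rV[R]_n) (A1 : 'M[R]_(m, n)) (b1 : 'cV[R]_m) (xs : I -> 'cV[R]_n)
    (x : 'cV[R]_n) (lambda : {ffun I -> R}) : Prop :=
  is_max (dw_primal_feasible A1 b1 xs) (fun z => dotp c z.1) (x, lambda).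

(* A dual solution is the triple (u, pi, pi0). *)
Definition dw_dual_feasible (R : realType) (n m : nat) (I : finType)
    (c : 'rV[R]_n) (A1 : 'M[R]_(m, n)) (xs : I -> 'cV[R]_n) :
    set ('rV[R]_m * 'rV[R]_n * R) :=
  [set w | let: (u, pi, pi0) := w in
     [/\ u *m A1 + pi = c,
         forall i, dotp pi (xs i) <= pi0
       & forall k, 0 <= u 0 k]].

Definition dw_dual_optimal (R : realType) (n m : nat) (I : finType)
    (c : 'rV[R]_n) (A1 : 'M[R]_(m, n)) (b1 : 'cV[R]_m) (xs : I -> 'cV[R]_n)
    (w : 'rV[R]_m * 'rV[R]_n * R) : Prop :=
  is_min (dw_dual_feasible c A1 xs)
    (fun '(u, _, pi0) => dotp u b1 + pi0) w.

Definition segment (R : realType) (n : nat) (x y : 'cV[R]_n) : set 'cV[R]_n :=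
  [set z | exists t : R, 0 <= t <= 1 /\ z = (1 - t) *: x + t *: y].

(* The library norm on matrices is the sup norm, hence this definition. *)
Definition euclidean_dist (R : realType) (n : nat) (x y : 'cV[R]_n) : R :=
  Num.sqrt (\sum_i (x i 0 - y i 0) ^+ 2).

(* xstar is what separating xcheck from Q, with the directional normalization
   toward xhat, returns: the point of Q on [xhat, xcheck] farthest from xhat. *)
Definition subproblem_point (R : realType) (n : nat) (Q : set 'cV[R]_n)
    (xhat xcheck xstar : 'cV[R]_n) : Prop :=
  is_max (Q `&` segment xhat xcheck) (euclidean_dist xhat) xstar.

Definition invalidates (R : realType) (n m : nat) (Q : set 'cV[R]_n)
    (y : 'cV[R]_n) (w : 'rV[R]_m * 'rV[R]_n * R) : Prop :=
  let: (_, pi, pi0) := w in Q y /\ pi0 < dotp pi y.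

(* Main.v *)
(** By linear programming duality every optimal dual solution satisfies
    [u b1 + pi0 <= c xhat].  If [xstar = xhat] then [pi xstar <= pi0] for all of
    them.  Otherwise [c xstar > c xhat], because [c] is strictly larger at
    [xcheck] than at [xhat]; as [xstar] lies in the convex set [LR_1],
    [u A1 xstar <= u b1], and subtracting gives [pi xstar > pi0] for all of
    them. *)

Require Import Defs.
From mathcomp Require Import all_boot all_order all_algebra.
From mathcomp Require Import all_classical all_reals all_analysis.
From mathcomp Require Import lra.

Set Implicit Arguments.
Unset Strict Implicit.
Unset Printing Implicit Defensive.

Import Order.TTheory GRing.Theory Num.Theory.
Import numFieldNormedType.Exports.

Local Open Scope classical_set_scope.
Local Open Scope ring_scope.

Section DotProduct.
Variables (R : realType) (n : nat).
Implicit Types (a b : 'rV[R]_n) (x y : 'cV[R]_n) (k : R).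

Lemma dotpE a x : dotp a x = \sum_i a 0 i * x i 0.
Proof. by rewrite /dotp mxE. Qed.

Lemma dotpDl a b x : dotp (a + b) x = dotp a x + dotp b x.
Proof. by rewrite /dotp mulmxDl mxE. Qed.

Lemma dotpBl a b x : dotp (a - b) x = dotp a x - dotp b x.
Proof. by rewrite /dotp mulmxBl !mxE. Qed.

Lemma dotpDr a x y : dotp a (x + y) = dotp a x + dotp a y.
Proof. by rewrite /dotp mulmxDr mxE. Qed.

Lemma dotpZr a k x : dotp a (k *: x) = k * dotp a x.
Proof. by rewrite /dotp -scalemxAr mxE. Qed.

Lemma dotp_sumr (I : finType) a (F : I -> 'cV[R]_n) :
  dotp a (\sum_i F i) = \sum_i dotp a (F i).
Proof. by rewrite /dotp mulmx_sumr summxE. Qed.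

Lemma dotp_mulmx m (u : 'rV[R]_m) (A : 'M[R]_(m, n)) x :
  dotp (u *m A) x = dotp u (A *m x).
Proof. by rewrite /dotp mulmxA. Qed.

Lemma mulmx_dotp m (A : 'M[R]_(m, n)) x i : (A *m x) i 0 = dotp (row i A) x.
Proof. by rewrite /dotp -row_mul [RHS]mxE. Qed.

Lemma ler_dotp a x y :
  (forall i, 0 <= a 0 i) -> (forall i, x i 0 <= y i 0) -> dotp a x <= dotp a y.
Proof.
move=> a_ge0 le_xy; rewrite !dotpE; apply: ler_sum => i _.
exact: ler_wpM2l (le_xy i).
Qed.

(** Carries an inequality from the generators [xs i] to [xhat]; applied to the rows of [D] and to
    [pi]. *)
Lemma dotp_convex_comb (I : finType) a (F : I -> 'cV[R]_n) (l : I -> R) k :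
    (forall i, 0 <= l i) -> \sum_i l i = 1 -> (forall i, dotp a (F i) <= k) ->
  dotp a (\sum_i l i *: F i) <= k.
Proof.
move=> l_ge0 l_sum1 aF_le; rewrite dotp_sumr -[k]mul1r -l_sum1 mulr_suml.
by apply: ler_sum => i _; rewrite dotpZr; exact: ler_wpM2l (aF_le i).
Qed.

End DotProduct.

Lemma polyhedron_segment (R : realType) (m n : nat) (A : 'M[R]_(m, n))
    (b : 'cV[R]_m) (x y : 'cV[R]_n) :
  polyhedron A b x -> polyhedron A b y -> segment x y `<=` polyhedron A b.
Proof.
move=> Ax Ay z [t [/andP[t_ge0 t_le1] ->]] i.
have s_ge0 : 0 <= 1 - t by rewrite subr_ge0.
rewrite mulmx_dotp dotpDr !dotpZr -!mulmx_dotp.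
have := ler_wpM2l s_ge0 (Ax i); have := ler_wpM2l t_ge0 (Ay i); lra.
Qed.

(* Bartl's induction on the number of rows: if dropping the first row [a] breaks
   the implication at some [x0], normalized to [a x0 = 1], apply the induction
   hypothesis to the forms composed with the projection [x - (a x) x0] onto the
   kernel of [a]. *)
Lemma farkas (R : realType) (m n : nat) (A : 'M[R]_(m, n)) (b : 'rV[R]_n) :
    (forall x, polyhedron A 0 x -> dotp b x <= 0) ->
  exists2 u : 'rV[R]_m, (forall i, 0 <= u 0 i) & b = u *m A.
Proof.
elim: m A b => [|m IHm] A b Ab.
  (* With no rows, [b x <= 0] holds for every [x]; testing plus and minus each unit vector forces
     [b = 0]. *)
  exists 0 => [[]//|]; rewrite mul0mx.
  apply/rowP => j; rewrite mxE.
  have b_le0 x : dotp b x <= 0 by apply: Ab => -[].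
  have dotp_delta : dotp b (delta_mx j 0) = b 0 j.
    rewrite /dotp -[b]trmxK -trmx_delta -trmx_mul.
    by rewrite mxE -rowE !mxE.
  apply/eqP; rewrite eq_le -dotp_delta b_le0 /=.
  have := b_le0 ((-1) *: delta_mx j 0).
  by rewrite dotpZr mulN1r oppr_le0.
rewrite -[m.+1]/(1 + m)%N in A Ab *.
rewrite -[A]vsubmxK in Ab *.
move: (usubmx A) (dsubmx A) Ab => a {}A Ab.
have aAP x : dotp a x <= 0 -> polyhedron A 0 x -> dotp b x <= 0.
  move=> ax Ax; apply: Ab => i; rewrite mul_col_mx [leRHS]mxE.
  have [j ->|j ->] := split_ordP i; first by rewrite col_mxEu ord1.
  by have := Ax j; rewrite col_mxEd [leRHS]mxE.
have [bP|] := pselect (forall x, polyhedron A 0 x -> dotp b x <= 0).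
  have [u u_ge0 bE] := IHm A b bP.
  (* The row [a] is redundant here and gets multiplier 0. *)
  exists (row_mx 0 u) => [i|]; last by rewrite mul_row_col mul0mx add0r.
  have [j ->|j ->] := split_ordP i; last by rewrite row_mxEr.
  by rewrite row_mxEl mxE.
move=> /existsNP[x1 /not_implyP[Ax1 /negP]]; rewrite -ltNge => bx1.
have ax1 : 0 < dotp a x1.
  by rewrite ltNge; apply/negP => ax1; have := aAP _ ax1 Ax1; rewrite leNgt bx1.
pose x0 := (dotp a x1)^-1 *: x1.
have ax0 : dotp a x0 = 1 by rewrite dotpZr mulVf// gt_eqF.
have bx0 : 0 < dotp b x0 by rewrite dotpZr mulr_gt0// invr_gt0.
have Ax0 i : (A *m x0) i 0 <= 0.
  rewrite -scalemxAr mxE; apply: mulr_ge0_le0; first by rewrite invr_ge0 ltW.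
  by have := Ax1 i; rewrite [X in _ <= X]mxE.
have [x Ax|u u_ge0 bE] := IHm (A - A *m x0 *m a) (b - b *m x0 *m a).
  have -> : dotp (b - b *m x0 *m a) x = dotp b (x - x0 *m (a *m x)).
    by rewrite /dotp mulmxBl mulmxBr !mulmxA.
  apply: aAP => [|i].
    rewrite /dotp mulmxBr mulmxA [a *m x0]mx11_scalar.
    by rewrite -[(a *m x0) 0 0]/(dotp a x0) ax0 mul1mx subrr mxE.
  by have := Ax i; rewrite mulmxBl mulmxBr !mulmxA.
(* The multiplier of [a] is read off [bE] by collecting the terms in [a]. It is nonnegative since
   [b x0 > 0], [u >= 0] and [A x0 <= 0]. *)
exists (row_mx (b *m x0 - u *m (A *m x0)) u) => [i|].
  have [j ->|j ->] := split_ordP i; last by rewrite row_mxEr.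
  rewrite row_mxEl ord1 !mxE -[X in X - _]dotpE -[X in _ - X]dotpE subr_ge0.
  apply: le_trans (ltW bx0); rewrite -[leRHS](_ : dotp u 0 = 0).
    by apply: ler_dotp => // k; rewrite [leRHS]mxE.
  by rewrite /dotp mulmx0 mxE.
rewrite mul_row_col mulmxBl; move/eqP: bE.
rewrite subr_eq => /eqP {1}->.
by rewrite mulmxBr !mulmxA addrAC -addrA addrC.
Qed.

(* Since the weights of a feasible point sum to 1, [A1 x <= b1] becomes
   [sum_i lambda_i (A1 x_i - b1) <= 0], homogeneous in [lambda]; optimality of
   [x] then says [sum_i lambda_i (c x_i - c x) <= 0] on that cone. *)
Lemma dw_strong_duality (R : realType) (n m : nat) (I : finType)
    (c : 'rV[R]_n) (A1 : 'M[R]_(m, n)) (b1 : 'cV[R]_m) (xs : I -> 'cV[R]_n)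
    (x : 'cV[R]_n) (lambda : {ffun I -> R}) :
    dw_primal_optimal c A1 b1 xs x lambda ->
  exists u pi pi0,
    dw_dual_feasible c A1 xs (u, pi, pi0) /\ dotp u b1 + pi0 = dotp c x.
Proof.
move=> [_ x_max].
pose G := \matrix_(k < m, j < #|I|) (A1 *m xs (enum_val j) - b1) k 0.
pose g := \row_(j < #|I|) (dotp c (xs (enum_val j)) - dotp c x).
(* The block [- 1%:M] encodes [y >= 0], so the cone consists of unnormalized weights [y] with
   [G y <= 0]. *)
have [y Py|v v_ge0 gE] := @farkas R _ _ (col_mx G (- 1%:M)) g.
  have y_ge0 j : 0 <= y j 0.
    have := Py (rshift m j).
    by rewrite mul_col_mx col_mxEd mulNmx mul1mx !mxE oppr_le0.
  have Gy k : (G *m y) k 0 <= 0.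
    by have := Py (lshift _ k); rewrite mul_col_mx col_mxEu [leRHS]mxE.
  pose s := \sum_j y j 0.
  (* A zero sum forces [y = 0], where [g] vanishes; otherwise dividing by [s] turns [y] into weights
     of a feasible point. *)
  have [s0|s_neq0] := eqVneq s 0.
    have y0 j : y j 0 = 0 by apply: (psumr_eq0P _ s0) => // i _.
    by rewrite dotpE big1// => j _; rewrite y0 mulr0.
  have s_gt0 : 0 < s by rewrite lt_def s_neq0 sumr_ge0.
  pose l := [ffun i : I => s^-1 * y (enum_rank i) 0].
  have sumlE (F : I -> R) :
      \sum_i l i * F i = s^-1 * \sum_j y j 0 * F (enum_val j).
    rewrite mulr_sumr (reindex (@enum_val I predT))/=; last first.
      exact/onW_bij/enum_val_bij.
    by apply: eq_bigr => j _; rewrite ffunE enum_valK mulrA.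
  have l_sum1 : \sum_i l i = 1.
    rewrite -[LHS]mulr1 mulr_suml sumlE.
    by under eq_bigr do rewrite mulr1; rewrite mulVf.
  pose z := \sum_i l i *: xs i.
  have z_feas : dw_primal_feasible A1 b1 xs (z, l).
    split=> // [k|i]; last by rewrite ffunE mulr_ge0// invr_ge0 ltW.
    rewrite -subr_le0.
    suff -> : (A1 *m z) k 0 - b1 k 0 = s^-1 * (G *m y) k 0.
      by rewrite pmulr_rle0// invr_gt0.
    rewrite -[b1 k 0]mul1r -l_sum1 mulr_suml mulmx_sumr summxE -sumrB.
    rewrite [in RHS]mxE; under [in RHS]eq_bigr do rewrite mxE mulrC.
    rewrite -(sumlE (fun i => (A1 *m xs i - b1) k 0)).
    by apply: eq_bigr => i _; rewrite -scalemxAr !mxE mulrBr.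
  have := x_max _ z_feas; rewrite /= -subr_le0.
  suff -> : dotp c z - dotp c x = s^-1 * dotp g y.
    by rewrite pmulr_rle0// invr_gt0.
  rewrite -[dotp c x]mul1r -l_sum1 mulr_suml dotp_sumr -sumrB.
  rewrite (dotpE g); under [in RHS]eq_bigr do rewrite mxE mulrC.
  rewrite -(sumlE (fun i => dotp c (xs i) - dotp c x)).
  by apply: eq_bigr => i _; rewrite dotpZr mulrBr.
(* Now [g = u G - w] with [w >= 0]. *)
pose u := lsubmx v; pose w := rsubmx v.
have u_ge0 k : 0 <= u 0 k by rewrite mxE.
(* [pi] is forced by the dual equation and [pi0] by the target value; the slack [pi0 - pi x_i] is
   then the entry of [w] at [i]. *)
exists u, (c - u *m A1), (dotp c x - dotp u b1).
split; last by rewrite addrC subrK.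
split=> // [|i]; first by rewrite addrC subrK.
have := congr1 (fun r : 'rV_#|I| => r 0 (enum_rank i)) gE.
rewrite -[v]hsubmxK -/u -/w mul_row_col mulmxN mulmx1 [LHS]mxE enum_rankK.
rewrite [RHS]mxE [(- w) _ _]mxE => giE.
have uG : (u *m G) 0 (enum_rank i) = dotp u (A1 *m xs i) - dotp u b1.
  rewrite mxE !dotpE -sumrB; apply: eq_bigr => k _.
  by rewrite !mxE enum_rankK mulrBr.
have w_ge0 : 0 <= w 0 (enum_rank i) by rewrite mxE.
have -> : dotp (c - u *m A1) (xs i) = dotp c (xs i) - dotp u (A1 *m xs i).
  by rewrite dotpBl dotp_mulmx.
move: giE; rewrite uG; lra.
Qed.

Theorem proposition1 (R : realType) (p q m1 m2 : nat)
    (c : 'rV[R]_(p + q))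
    (A1 : 'M[R]_(m1, p + q)) (b1 : 'cV[R]_m1)
    (A2 : 'M[R]_(m2, p + q)) (b2 : 'cV[R]_m2)
    (LR1_bounded : bounded_polyhedron (polyhedron A1 b1))
    (LR2_bounded : bounded_polyhedron (polyhedron A2 b2))
    (Q2_bounded : bounded_polyhedron (mixed_integer_hull A2 b2))
    (* inner approximation conv {x_i : i in I} *)
    (I : finType) (xs : I -> 'cV[R]_(p + q))
    (xs_Q2 : forall i, mixed_integer_hull A2 b2 (xs i))
    (inner_feasible :
       (polyhedron A1 b1 `&` conv_hull (range xs)) !=set0)
    (* outer approximation {x : D x <= d} *)
    (m3 : nat) (D : 'M[R]_(m3, p + q)) (d : 'cV[R]_m3)
    (outer_Q2 : mixed_integer_hull A2 b2 `<=` polyhedron D d)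
    (* solutions of the two master programs *)
    (xhat : 'cV[R]_(p + q)) (lambda : {ffun I -> R})
    (xhat_opt : dw_primal_optimal c A1 b1 xs xhat lambda)
    (xcheck : 'cV[R]_(p + q))
    (xcheck_opt :
       is_max (polyhedron A1 b1 `&` polyhedron D d) (dotp c) xcheck)
    (* the method does not stop, so the sub-problem is solved *)
    (not_stopped : dotp c xhat <> dotp c xcheck)
    (xstar : 'cV[R]_(p + q))
    (xstar_sub :
       subproblem_point (mixed_integer_hull A2 b2) xhat xcheck xstar) :
  (forall w : 'rV[R]_m1 * 'rV[R]_(p + q) * R,
     dw_dual_optimal c A1 b1 xs w ->
     invalidates (mixed_integer_hull A2 b2) xstar w) \/
  (forall w : 'rV[R]_m1 * 'rV[R]_(p + q) * R,
     dw_dual_optimal c A1 b1 xs w ->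
     ~ invalidates (mixed_integer_hull A2 b2) xstar w).
Proof.
have [[xhat_A1 xhatE l_sum1 l_ge0] _] := xhat_opt.
have [[xcheck_A1 _] xcheck_max] := xcheck_opt.
have [[xstar_Q2 xstar_seg] _] := xstar_sub.
(* [xhat] is feasible for the Fenchel master, as the [xs i] lie in [Q_2] and hence satisfy the outer
   inequalities. *)
have lt_c : dotp c xhat < dotp c xcheck.
  rewrite lt_neqAle; apply/andP; split; first exact/eqP.
  apply: xcheck_max; split=> // k.
  rewrite mulmx_dotp xhatE; apply: dotp_convex_comb => // i.
  by rewrite -mulmx_dotp; exact: outer_Q2.
have xstar_A1 := polyhedron_segment xhat_A1 xcheck_A1 xstar_seg.
have [t [/andP[t_ge0 t_le1] xstarE]] := xstar_seg.
(* The dichotomy depends only on the position of [xstar] on the segment, not on the dual solution;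
   [t = 0] means [xstar = xhat]. *)
have [t0|t_neq0] := eqVneq t 0.
  right=> -[[u pi] pi0] [[_ pi_xs _] _] [_]; apply/negP; rewrite -leNgt.
  rewrite xstarE t0 subr0 scale1r scale0r addr0 xhatE.
  exact: dotp_convex_comb.
left=> -[[u pi] pi0] [[cE pi_xs u_ge0] w_min]; split=> //.
(* A dual feasible point of value [c xhat] bounds the value of every optimal one. *)
have [u' [pi' [pi0' [w'_feas w'_val]]]] := dw_strong_duality xhat_opt.
have := w_min _ w'_feas; rewrite w'_val => w_val.
have lt_cstar : dotp c xhat < dotp c xstar.
  have t_gt0 : 0 < t by rewrite lt_def t_neq0.
  rewrite xstarE dotpDr !dotpZr.
  by move: lt_c; rewrite -(ltr_pM2l t_gt0); lra.
have uA1_le : dotp u (A1 *m xstar) <= dotp u b1 by exact: ler_dotp.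
have : dotp c xstar = dotp u (A1 *m xstar) + dotp pi xstar.
  by rewrite -cE dotpDl dotp_mulmx.
lra.
Qed.
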